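(* There exist $\theta_0>0$ and $\kappa_0<\infty$ such that for every integer $n\ge1$ there exists a coupling of $S_n$ with $S_{4n}$ such that $$\mathbf{E}\left[e^{\theta_0|2S_n-S_{4n}|}\right]\le\kappa_0.$$ In fact, any $\theta_0>0$ such that $8\theta_0^2e^{2\theta_0}<1$ works; that is, for every such $\theta_0$ there is $\kappa_0<\infty$ (not depending on $n$) such that for every $n\ge 1$ a coupling of $S_n$ with $S_{4n}$ satisfying $\mathbf{E}\left[e^{\theta_0|2S_n-S_{4n}|}\right]\le\kappa_0$ exists.
   Context: For each $N\ge 1$, $S_N$ denotes a random variable distributed as $X_1+\ldots+X_N$ where $X_i$ are i.i.d. with $X_i=\pm1$ with probability $1/2$ each. A coupling of random variables $X,Y$ satisfying certain statements means a probability space carrying random variables with the same marginal distributions as $X$ and $Y$ respectively and satisfying the stated mutual relationships (so in the coupling, only the marginal laws of $S_n$ and $S_{4n}$ are prescribed). *)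

(* Defs.v *)
From HB Require Import structures.
From mathcomp Require Export all_boot all_order all_algebra.
From mathcomp Require Export all_classical all_reals all_analysis.

Set Implicit Arguments.
Unset Strict Implicit.
Unset Printing Implicit Defensive.

Import Order.TTheory GRing.Theory Num.Theory.

Local Open Scope classical_set_scope.
Local Open Scope ring_scope.

Definition mutually_independent (R : realType) (d : measure_display)
    (T : measurableType d) (P : probability T R) (I : finType)
    (X : I -> {RV P >-> R}) : Prop :=
  forall (J : {set I}) (A : I -> set R),
    (forall i, i \in J -> measurable (A i)) ->
    P [set w | forall i, i \in J -> A i (X i w)] =
      (\prod_(i in J) P [set w | A i (X i w)])%E.

Definition fair_sign (R : realType) (d : measure_display)
    (T : measurableType d) (P : probability T R) (X : {RV P >-> R}) : Prop :=
  P [set w | X w = 1] = (2^-1)%:E /\ P [set w | X w = -1] = (2^-1)%:E.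

Definition sum_of_iid_signs (R : realType) (d : measure_display)
    (T : measurableType d) (P : probability T R) (N : nat)
    (S : {RV P >-> R}) : Prop :=
  exists X : 'I_N -> {RV P >-> R},
    [/\ mutually_independent X,
        forall i, fair_sign (X i) &
        forall w, S w = \sum_(i < N) X i w].

(* The distributions are compared on Borel sets only: outside the
   sigma-algebra the values of a [probability] are meaningless. *)
Definition same_distribution (R : realType)
    (d1 : measure_display) (T1 : measurableType d1) (P1 : probability T1 R)
    (d2 : measure_display) (T2 : measurableType d2) (P2 : probability T2 R)
    (X : {RV P1 >-> R}) (Y : {RV P2 >-> R}) : Prop :=
  forall A : set R, measurable A -> distribution P1 X A = distribution P2 Y A.

(* [S] has the law of S_N. The signs may live on another probability space
   than [S], so only the marginal law of [S] is constrained. *)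
Definition distributed_as_S (R : realType) (N : nat) (d : measure_display)
    (T : measurableType d) (P : probability T R) (S : {RV P >-> R}) : Prop :=
  exists (d' : measure_display) (T' : measurableType d')
         (P' : probability T' R) (S' : {RV P' >-> R}),
    sum_of_iid_signs N S' /\ same_distribution S S'.

Definition is_coupling_S (R : realType) (N M : nat) (d : measure_display)
    (T : measurableType d) (P : probability T R) (X Y : {RV P >-> R}) : Prop :=
  distributed_as_S N X /\ distributed_as_S M Y.

(* Main.v *)
(** Write S_n = 2 i - n and S_4n = 2 k - 4 n with i, k binomial.  Both binomial laws
    are stationary for chains whose jumps have the same size in [2 S_n] and in
    [S_4n]: i moves by 1 with rates n - i and i, while k moves by 2 with rates
    (4n - k)(4n - k - 1) / 8n and k (k - 1) / 8n.  Run the two chains jointly,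
    performing common jumps at the minimum of the two rates.  The rates of the up
    (and of the down) jumps differ only by a multiple of the gap
    F = 2 S_n - S_4n plus V + O(1), where V = S_4n^2 / 32n.  Hence F jumps only
    towards 0 once |F| >= 4 (V + 1), and
      L exp (theta F) <= - alpha exp (theta F) + K exp (2 V).
    Since E exp (2 V) = E exp (S_4n^2 / 16n) <= exp (1 / 2) uniformly in n, each
    step contracts E exp (theta |F|) up to a bounded error while preserving the two
    marginal laws; iterating from the product coupling gives the bound for every
    theta <= 3 / 8, and 8 theta^2 exp (2 theta) < 1 forces theta^2 < 1 / 8. *)

Require Import Defs.
From HB Require Import structures.
From mathcomp Require Import all_boot all_order all_algebra.
From mathcomp Require Import all_classical all_reals all_analysis.
From mathcomp Require Import ring lra zify.

Set Implicit Arguments.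
Unset Strict Implicit.
Unset Printing Implicit Defensive.

Import Order.TTheory GRing.Theory Num.Theory.
Import numFieldNormedType.Exports.

Local Open Scope classical_set_scope.
Local Open Scope ring_scope.

(** * Exponential inequalities *)

Lemma double_fact_ge (j : nat) : (2 ^ j * j`! <= (j.*2)`!)%N.
Proof.
elim: j => [|j IH]; first by [].
rewrite doubleS !factS expnS.
have -> : (2 * 2 ^ j * (j.+1 * j`!) = (2 * j.+1) * (2 ^ j * j`!))%N by lia.
rewrite leq_mul //; first by lia.
by rewrite (leq_trans IH) // leq_pmull.
Qed.

Section real_inequalities.
Variable R : realType.
Implicit Types t x : R.

(** Termwise comparison of power series: odd terms cancel on the left, and the even term 2 t^(2j) /
    (2j)! is at most 2 (t^2/2)^j / j! because 2^j j! <= (2j)!. *)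
Lemma expRDexpRN_le t : expR t + expR (- t) <= 2 * expR (t ^+ 2 / 2).
Proof.
have cvgs x : series (exp_coeff x) @ \oo --> expR x.
  exact: is_cvg_series_exp_coeff.
have cs : (series (exp_coeff t) + series (exp_coeff (- t))) @ \oo -->
    expR t + expR (- t) by exact: cvgD.
rewrite -(cvg_lim _ cs)//; apply: limr_le; first by apply/cvg_ex; eexists; exact: cs.
apply: nearW => N.
rewrite /= !fctE.
(* There are [uphalf N] even indices below [N], hence this many terms of the second series. *)
apply: (@le_trans _ _ (2 * series (exp_coeff (t ^+ 2 / 2)) (uphalf N))).
  elim: N => [|N IH]; first by rewrite /= !seriesEnat /= !big_geq // mulr0 addr0.
  have sS (u : R^nat) j : series u j.+1 = series u j + u j.
    by rewrite seriesEnat /= big_nat_recr.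
  rewrite !(sS _ N).
  have [oN|eN] := boolP (odd N).
    have -> : uphalf N.+1 = uphalf N by lia.
    rewrite {2 4}/exp_coeff /= exprNn -signr_odd oN expr1.
    by rewrite mulN1r mulNr addrACA subrr addr0.
  have -> : uphalf N.+1 = (uphalf N).+1 by lia.
  have term : exp_coeff t N + exp_coeff (- t) N <= 2 * exp_coeff (t ^+ 2 / 2) (uphalf N).
    have -> : N = (uphalf N).*2 by lia.
    have -> : uphalf (uphalf N).*2 = uphalf N by lia.
    move: (uphalf N) => j; rewrite /exp_coeff /= exprNn -signr_odd odd_double expr0 mul1r.
    rewrite -[leLHS]mulr2n -[leLHS]mulr_natl ler_pM2l // -mul2n exprM expr_div_n.
    rewrite -mulrA; apply: ler_wpM2l; first by rewrite exprn_ge0 // sqr_ge0.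
    rewrite -invfM lef_pV2 ?posrE.
    - by rewrite mul2n -natrX -natrM ler_nat double_fact_ge.
    - by rewrite ltr0n fact_gt0.
    - by rewrite mulr_gt0 ?exprn_gt0 // ltr0n fact_gt0.
  rewrite sS; lra.
rewrite ler_pM2l //.
have pos j : 0 <= exp_coeff (t ^+ 2 / 2) j by rewrite divr_ge0 ?exprn_ge0 ?divr_ge0 ?sqr_ge0.
have nd : nondecreasing_seq (series (exp_coeff (t ^+ 2 / 2))).
  by apply: nondecreasing_series.
apply: nondecreasing_cvgn_le => //; exact: is_cvg_series_exp_coeff.
Qed.

(** Gives the number of chain steps after which the initial value [A] is forgotten: (1 - s)^t <=
    exp(- s t), and exp(s t) >= s t >= A once t >= A / s. *)
Lemma exprn_contraction_le1 (s A : R) : 0 < s -> s <= 1 -> 0 <= A ->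
  exists t : nat, (1 - s) ^+ t * A <= 1.
Proof.
move=> s0 s1 A0.
have [t ht] : exists t : nat, A / s <= t%:R.
  exists (Num.truncn (A / s)).+1; exact/ltW/truncnS_gt.
exists t; rewrite ler_pdivrMr // in ht.
apply: (@le_trans _ _ (expR (- s) ^+ t * A)).
  rewrite ler_wpM2r // lerXn2r ?nnegrE ?expR_ge0 ?subr_ge0 //.
  by apply: le_trans (expR_ge1Dx _); lra.
rewrite -expRM_natl mulrN expRN mulrC ler_pdivrMr ?expR_gt0 // mul1r.
by apply: le_trans (expR_ge1Dx _); lra.
Qed.

End real_inequalities.

(** * Binomial expectations: stationarity and Gaussian moment *)

Section binomial_mean.
Variable R : realType.
Implicit Types (g h : nat -> R) (N : nat).

Definition binomial_mean N g : R := \sum_(k < N.+1) 'C(N, k)%:R / 2 ^+ N * g k.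

(** Pascal's rule, that is, conditioning on one toss. *)
Lemma binomial_meanS N g :
  binomial_mean N.+1 g = binomial_mean N (fun k => (g k + g k.+1) / 2).
Proof.
rewrite /binomial_mean.
have -> : \sum_(k < N.+1) 'C(N, k)%:R / 2 ^+ N * ((g k + g k.+1) / 2) =
   (2 ^+ N.+1)^-1 * (\sum_(k < N.+2) 'C(N, k)%:R * g k
     + \sum_(k < N.+1) 'C(N, k)%:R * g k.+1).
  rewrite [in RHS]big_ord_recr /= bin_small // mul0r addr0 -big_split /= mulr_sumr.
  by apply: eq_bigr => k _; rewrite exprS invfM; ring.
rewrite [X in _ = _ * (X + _)]big_ord_recl /= -addrA -big_split /= big_ord_recl /=.
rewrite mulrDr mulr_sumr !bin0; congr (_ + _); first by ring.
by apply: eq_bigr => k _; rewrite /bump /= add1n binS natrD; ring.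
Qed.

Lemma binomial_mean_le N g h : (forall k, (k <= N)%N -> g k <= h k) ->
  binomial_mean N g <= binomial_mean N h.
Proof.
move=> gh; apply: ler_sum => k _; apply: ler_wpM2l; last by apply: gh; rewrite -ltnS.
by rewrite divr_ge0 // exprn_ge0.
Qed.

Lemma binomial_meanP N (c : R) g h :
  binomial_mean N (fun k => c * g k + h k) = c * binomial_mean N g + binomial_mean N h.
Proof.
by rewrite /binomial_mean mulr_sumr -big_split; apply: eq_bigr => k _ /=; ring.
Qed.

(** Detailed balance (N - k) C(N, k) = (k + 1) C(N, k + 1); both stationarity statements reduce to
    it. *)
Lemma binomial_mean_shift N h :
  binomial_mean N (fun k => (N%:R - k%:R) * h k.+1) =
  binomial_mean N (fun k => k%:R * h k).
Proof.
rewrite /binomial_mean big_ord_recr big_ord_recl /= subrr !mul0r !mulr0 addr0 add0r.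
apply: eq_bigr => k _; rewrite /bump /= add1n.
have /(congr1 (fun x => x%:R : R)) := mul_bin_left N k.
rewrite !natrM natrB; last exact: ltnW.
by move=> e; rewrite !(mulrAC _ _ (_ * h _)) !mulrA (mulrC 'C(N, k.+1)%:R) e; ring.
Qed.

Lemma binomial_mean_cst N (c : R) : binomial_mean N (fun=> c) = c.
Proof.
elim: N => [|N IH]; first by rewrite /binomial_mean big_ord1 bin0 expr0; field.
by rewrite binomial_meanS -[RHS]IH; congr binomial_mean; apply/funext => _; field.
Qed.

Lemma binomial_mean_stationary1 N g :
  binomial_mean N (fun k => (N%:R - k%:R) * (g k.+1 - g k) +
                            k%:R * (g k.-1 - g k)) = 0.
Proof.
have -> : (fun k : nat => (N%:R - k%:R) * (g k.+1 - g k) + k%:R * (g k.-1 - g k)) =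
  (fun k => -1 * (k%:R * (g k - g k.-1)) + (N%:R - k%:R) * (g k.+1 - g k)).
  by apply/funext => k; ring.
rewrite binomial_meanP (binomial_mean_shift N (fun k => g k - g k.-1)).
by rewrite mulN1r addNr.
Qed.

(** Two uses of the balance identity carry the weight (N - k)(N - k - 1) at k to the weight (k +
    2)(k + 1) at k + 2, so the flow of up jumps cancels that of down jumps. *)
Lemma binomial_mean_stationary2 N g :
  binomial_mean N (fun k =>
    (N%:R - k%:R) * (N%:R - k%:R - 1) * (g k.+2 - g k) +
    k%:R * (k%:R - 1) * (g (k - 2)%N - g k)) = 0.
Proof.
pose h k := g k - g (k - 2)%N.
have -> : (fun k => (N%:R - k%:R) * (N%:R - k%:R - 1) * (g k.+2 - g k) +
    k%:R * (k%:R - 1) * (g (k - 2)%N - g k)) =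
  (fun k => -1 * (k%:R * ((k%:R - 1) * h k)) +
    (N%:R - k%:R) * ((N%:R - k.+1%:R) * h k.+2)).
  by apply/funext => k; rewrite /h !subn2 /= -natr1; ring.
rewrite binomial_meanP (binomial_mean_shift N (fun k => (N%:R - k%:R) * h k.+1)).
have -> : (fun k => k%:R * ((N%:R - k%:R) * h k.+1)) =
  (fun k => (N%:R - k%:R) * ((k.+1%:R - 1) * h k.+1)).
  by apply/funext => k; rewrite -natr1; ring.
rewrite (binomial_mean_shift N (fun k => (k%:R - 1) * h k)).
by rewrite mulN1r addNr.
Qed.

(* Along [lambda_N = 1 / (2 m + 2 N)] one has [lambda_N + 2 lambda_N ^ 2 <= lambda_(N - 1)],
   which absorbs the factor [cosh (2 lambda s) <= exp (2 lambda ^ 2 s ^ 2)] of each step. *)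
Lemma binomial_mean_gauss_rec m N : (0 < m)%N ->
  binomial_mean N
    (fun k => expR ((2 * k%:R - N%:R) ^+ 2 / (2 * m%:R + 2 * N%:R))) <=
  expR (N%:R / (2 * m%:R)).
Proof.
move=> m0; have M0 : 0 < m%:R :> R by rewrite ltr0n.
elim: N => [|N IH].
  by rewrite /binomial_mean big_ord1 bin0 expr0 /= mulr0 subr0 expr0n /= !mul0r expR0; lra.
rewrite binomial_meanS.
pose a : R := expR ((2 * m%:R)^-1).
have -> : expR (N.+1%:R / (2 * m%:R)) = a * expR (N%:R / (2 * m%:R)).
  by rewrite /a -expRD -natr1; congr expR; ring.
have a0 : 0 < a by exact: expR_gt0.
apply: (@le_trans _ _ (a * binomial_mean N (fun k =>
  expR ((2 * k%:R - N%:R) ^+ 2 / (2 * m%:R + 2 * N%:R))))); last by rewrite ler_pM2l.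
rewrite -[leRHS]addr0 -(binomial_mean_cst N 0) -binomial_meanP.
apply: binomial_mean_le => k _; rewrite addr0.
set s : R := 2 * k%:R - N%:R.
have -> : 2 * k%:R - N.+1%:R = s - 1 :> R by rewrite /s -natr1; ring.
have -> : 2 * k.+1%:R - N.+1%:R = s + 1 :> R by rewrite /s -!natr1; ring.
set L : R := 2 * m%:R + 2 * N.+1%:R.
have N0 : 0 <= N%:R :> R by [].
have -> : 2 * m%:R + 2 * N%:R = L - 2 by rewrite /L -natr1; ring.
have L2 : 2 < L by rewrite /L -natr1; lra.
have Lm : 2 * m%:R <= L by rewrite /L -natr1; lra.
have L0 : L != 0 by lra.
have -> : (expR ((s - 1) ^+ 2 / L) + expR ((s + 1) ^+ 2 / L)) / 2 =
   expR ((s ^+ 2 + 1) / L) * (expR (2 * s / L) + expR (- (2 * s / L))) / 2.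
  rewrite mulrDr -!expRD addrC; congr ((expR _ + expR _) / 2); by field.
apply: (@le_trans _ _ (expR ((s ^+ 2 + 1) / L) * expR ((2 * s / L) ^+ 2 / 2))).
  rewrite -mulrA ler_pM2l ?expR_gt0 // ler_pdivrMr //.
  by rewrite [leRHS]mulrC; exact: expRDexpRN_le.
rewrite /a -!expRD ler_expR.
have -> : (s ^+ 2 + 1) / L + (2 * s / L) ^+ 2 / 2 =
  L^-1 + s ^+ 2 * (L^-1 + 2 * L^-1 ^+ 2) by field.
apply: lerD; first by rewrite lef_pV2 // posrE; lra.
apply: ler_wpM2l; first exact: sqr_ge0.
(* What remains is (L + 2) / L^2 <= 1 / (L - 2), that is, L^2 - 4 <= L^2. *)
have -> : L^-1 + 2 * L^-1 ^+ 2 = (L + 2) / L ^+ 2 by field.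
rewrite ler_pdivrMr ?exprn_gt0; [|lra..].
rewrite mulrC ler_pdivlMr; last lra.
have : 0 <= 4 :> R by []. nra.
Qed.

Lemma binomial_mean_gauss m : (0 < m)%N ->
  binomial_mean m (fun k => expR ((2 * k%:R - m%:R) ^+ 2 / (4 * m%:R))) <= expR (2^-1).
Proof.
move=> m0; have := binomial_mean_gauss_rec m m0.
have M0 : m%:R != 0 :> R by rewrite pnatr_eq0 -lt0n.
have -> : 2 * m%:R + 2 * m%:R = 4 * m%:R :> R by ring.
by have -> : m%:R / (2 * m%:R) = 2^-1 :> R by field.
Qed.

End binomial_mean.

(** * The drift inequality for one exponential of the gap *)

Section drift.
Variable R : realType.
Implicit Types theta F V e : R.

(** Collects, with some slack, the errors of the case F < 4 (V + 1): with Q = exp(4 theta), the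
    jumps away from 0 cost at most Q (6 Q + 1 / (2 theta)) and restoring the term in exp(theta F)
    costs 2 Q, both in units of exp(2 V). *)
Definition drift_const theta : R :=
  expR (4 * theta) * (8 * expR (4 * theta) + (2 * theta)^-1) + 2 * expR (4 * theta).

Lemma drift_const_ge0 theta : 0 < theta -> 0 <= drift_const theta.
Proof.
move=> t0; have e0 := expR_gt0 (4 * theta).
by rewrite addr_ge0 ?mulr_ge0 ?addr_ge0 ?mulr_ge0 ?invr_ge0 ?mulr_ge0 // ltW.
Qed.

(* If [F >= 4 (V + 1)], the only possible jumps are [F -> F - 4], at total rate at least 1;
   otherwise [exp (theta F) <= exp (4 theta (V + 1))] and the rates are O(V + |F|). *)
Lemma expR_drift theta F V e u1 u2 d1 d2 :
  0 < theta -> theta <= 3 / 8 -> 0 <= V -> `|e| <= 4^-1 ->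
  u2 - u1 = V - 4^-1 + e + F / 4 -> d2 - d1 = V - 4^-1 - e - F / 4 ->
  (u2 - Num.min u1 u2 + (d1 - Num.min d1 d2)) *
    (expR (theta * (F - 4)) - expR (theta * F)) +
  (u1 - Num.min u1 u2 + (d2 - Num.min d1 d2)) *
    (expR (theta * (F + 4)) - expR (theta * F)) <=
  - (1 - expR (- (4 * theta))) * expR (theta * F) + drift_const theta * expR (2 * V).
Proof.
move=> t0 t38 V0; rewrite ler_norml => /andP[e1 e2] hu hd.
have -> : theta * (F - 4) = - (4 * theta) + theta * F by ring.
have -> : theta * (F + 4) = 4 * theta + theta * F by ring.
rewrite !expRD.
have f0 := expR_gt0 (theta * F); set f := expR (theta * F) in f0 *.
have p1 : expR (- (4 * theta)) < 1 by rewrite expR_lt1; lra.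
have q1 : 1 < expR (4 * theta) by rewrite expR_gt1; lra.
set p := expR (- (4 * theta)) in p1 *.
have p0 : 0 < p by exact: expR_gt0.
have D0 := drift_const_ge0 t0.
have X0 := expR_gt0 (2 * V).
have [hF|hF] := leP (4 * (V + 1)) F.
  rewrite min_l; last lra.
  rewrite min_r; last lra.
  rewrite hu !subrr add0r mul0r addr0.
  have -> : d1 - d2 = - (V - 4^-1 - e - F / 4) by rewrite -hd opprB.
  have pf : 0 <= (1 - p) * f by rewrite mulr_ge0 // ltW // subr_gt0.
  have DX : 0 <= drift_const theta * expR (2 * V) by rewrite mulr_ge0 // ltW.
  (* The total rate (u2 - u1) + (d1 - d2) equals 2 e + F / 2, which is at least 3 / 2 here. *)
  have : 0 <= (2 * e + F / 2 - 1) * ((1 - p) * f) by rewrite mulr_ge0 //; lra.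
  lra.
set A := u2 - _ + _; set B := u1 - _ + _.
have A0 : 0 <= A by rewrite addr_ge0 // subr_ge0 ge_min lexx ?orbT.
have B0 : 0 <= B by rewrite addr_ge0 // subr_ge0 ge_min lexx ?orbT.
have FN := ler_norm F; have FN' := ler_norm (- F); rewrite normrN in FN'.
have BF : B <= (V + 1) + `|F| / 2.
  by rewrite /B; case: (leP u1 u2) => ?; case: (leP d1 d2) => ?; lra.
set Q := expR (4 * theta) in q1 *; set X := expR (2 * V) in X0 *.
(* Split exp(2 V) as [Y * W]: [W] dominates exp(4 theta V), which is where theta <= 3 / 8 enters,
   and [Y] absorbs the linear factor V + 1 <= 2 Y. *)
pose Y := expR (V / 2); pose W := expR (3 / 2 * V).
have XE : X = Y * W by rewrite /X /Y /W -expRD; congr expR; lra.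
have Y1 : 1 + V / 2 <= Y by exact: expR_ge1Dx.
have W0 : 0 < W by exact: expR_gt0.
have Q0 : 0 < Q by exact: expR_gt0.
have fQW : f <= Q * W.
  rewrite /f /Q /W -expRD ler_expR.
  have : 0 <= theta * (4 * (V + 1) - F) by rewrite mulr_ge0 //; lra.
  have : 0 <= (3 / 8 - theta) * V by rewrite mulr_ge0 //; lra.
  lra.
have VQW : (V + 1) * (Q * W) <= 2 * (Q * X).
  have : 0 <= (2 * Y - (V + 1)) * (Q * W) by rewrite !mulr_ge0 //; lra.
  rewrite XE; lra.
have Vf : (V + 1) * f <= 2 * (Q * X).
  by apply: le_trans VQW; rewrite ler_wpM2l //; lra.
have X1 : 1 <= X by apply: le_trans (expR_ge1Dx _); lra.
have Ff : `|F| * f <= 8 * (Q * X) + theta^-1.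
  have ti : 0 < theta^-1 by rewrite invr_gt0.
  have [F0|F0] := leP 0 F.
    rewrite ger0_norm //.
    have : F * f <= (4 * (V + 1)) * (Q * W).
      by apply: ler_pM => //; lra.
    lra.
  rewrite ltr0_norm //.
  (* For negative F, x exp(- x) <= 1 at x = - theta F bounds |F| exp(theta F) by 1 / theta. *)
  have f1 : f * expR (- (theta * F)) = 1 by exact: expRxMexpNx_1.
  have f2 : f * (- (theta * F)) <= 1.
    rewrite -[leRHS]f1 ler_pM2l //; apply: le_trans (expR_ge1Dx _); lra.
  have : - F * f <= theta^-1.
    by rewrite -[leRHS]mul1r ler_pdivlMr //; lra.
  have : 0 < Q * X by rewrite mulr_gt0.
  lra.
have Bf : B * f <= 6 * (Q * X) + (2 * theta)^-1.
  have : B * f <= (V + 1 + `|F| / 2) * f by rewrite ler_wpM2r // ltW.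
  have -> : (2 * theta)^-1 = theta^-1 / 2 by rewrite invfM mulrC.
  lra.
have Apf : 0 <= A * ((1 - p) * f) by rewrite !mulr_ge0 // ltW // subr_gt0.
have QBf : Q * (B * f) <= Q * (6 * (Q * X) + (2 * theta)^-1) by rewrite ler_wpM2l // ltW.
have Bf0 : 0 <= B * f by rewrite mulr_ge0 // ltW.
have pf : 0 <= p * f by rewrite mulr_ge0 // ltW.
have f2 : f <= 2 * (Q * X).
  apply: le_trans Vf; rewrite -[leLHS]mul1r ler_wpM2r //; lra.
have QX : 0 <= Q * (Q * X) by rewrite !mulr_ge0 // ltW.
have tQX : 0 <= Q * (2 * theta)^-1 * (X - 1).
  by rewrite !mulr_ge0 ?invr_ge0 //; lra.
rewrite /drift_const -/Q; lra.
Qed.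

End drift.

(** * The coupled chain and its contraction *)

Section coupled_chain.
Variables (R : realType) (n : nat).
Hypothesis n_gt0 : (0 < n)%N.
Implicit Types (g h : nat -> nat -> R) (i k : nat).

Let n_pos : 0 < n%:R :> R. Proof. by rewrite ltr0n. Qed.

Definition up1 i : R := n%:R - i%:R.
Definition down1 i : R := i%:R.
(** The normalisation by 8 n matches the rates of the other chain to leading order: at the centre, k
    = 2 n and i = n / 2, both are about n / 2. *)
Definition up2 k : R := ((4 * n)%:R - k%:R) * ((4 * n)%:R - k%:R - 1) / (8 * n%:R).
Definition down2 k : R := k%:R * (k%:R - 1) / (8 * n%:R).

(* At the boundary the truncated [i.-1] and [k - 2], as well as the values outside of
   [0, n] x [0, 4 n], only occur with rate 0. *)
Definition generator g i k : R :=
  Num.min (up1 i) (up2 k) * (g i.+1 k.+2 - g i k) +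
  (up1 i - Num.min (up1 i) (up2 k)) * (g i.+1 k - g i k) +
  (up2 k - Num.min (up1 i) (up2 k)) * (g i k.+2 - g i k) +
  (Num.min (down1 i) (down2 k) * (g i.-1 (k - 2)%N - g i k) +
  (down1 i - Num.min (down1 i) (down2 k)) * (g i.-1 k - g i k) +
  (down2 k - Num.min (down1 i) (down2 k)) * (g i (k - 2)%N - g i k)).

Definition step g i k : R := g i k + (5 * n%:R)^-1 * generator g i k.

Lemma natr_falling_ge0 (r : nat) : 0 <= r%:R * (r%:R - 1) :> R.
Proof.
case: r => [|r]; first by rewrite mul0r.
by rewrite mulr_ge0 // subr_ge0 ler1n.
Qed.

Lemma up1_ge0 i : (i <= n)%N -> 0 <= up1 i.
Proof. by move=> ?; rewrite subr_ge0 ler_nat. Qed.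

Lemma up2_ge0 k : (k <= 4 * n)%N -> 0 <= up2 k.
Proof.
by move=> kn; rewrite /up2 -natrB // divr_ge0 ?natr_falling_ge0 // mulr_ge0.
Qed.

Lemma down2_ge0 k : 0 <= down2 k.
Proof. by rewrite /down2 divr_ge0 ?natr_falling_ge0 // mulr_ge0. Qed.

Lemma falling_le (r : nat) : (r <= 4 * n)%N -> r%:R * (r%:R - 1) / (8 * n%:R) <= 2 * n%:R :> R.
Proof.
move=> rn; rewrite ler_pdivrMr ?mulr_gt0 //.
have r0 : 0 <= r%:R :> R by [].
have : r%:R <= 4 * n%:R :> R by rewrite -natrM ler_nat.
nra.
Qed.

Lemma up1_out i : (i <= n)%N -> (n < i.+1)%N -> up1 i = 0.
Proof. by move=> ? ?; rewrite /up1 (_ : i = n) ?subrr //; lia. Qed.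

Lemma up2_out k : (k <= 4 * n)%N -> (4 * n < k.+2)%N -> up2 k = 0.
Proof.
move=> k1 k2; rewrite /up2 -natrB //.
have [->|->] : (4 * n - k = 0 \/ 4 * n - k = 1)%N by lia.
- by rewrite mul0r mul0r.
- by rewrite subrr mulr0 mul0r.
Qed.

Lemma down2_out k : (k < 2)%N -> down2 k = 0.
Proof.
by case: k => [|[|]] // _; rewrite /down2 ?mul0r ?subrr ?mulr0 ?mul0r.
Qed.

(** The total jump rate is at most n + 2 n + 2 n = 5 n, so with time step 1 / (5 n) the holding
    probability is nonnegative. Up jumps leaving the rectangle have rate 0, so the uncontrolled
    values of [g] there do not matter. *)
Lemma step_ge0 g : (forall i k, (i <= n)%N -> (k <= 4 * n)%N -> 0 <= g i k) ->
  forall i k, (i <= n)%N -> (k <= 4 * n)%N -> 0 <= step g i k.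
Proof.
move=> g0 i k hi hk.
have u1 := up1_ge0 hi; have u2 := up2_ge0 hk.
have d1 : 0 <= down1 i by [].
have d2 := down2_ge0 k.
have gik := g0 i k hi hk.
have tot : up1 i + up2 k + down1 i + down2 k <= 5 * n%:R.
  have := falling_le hk; rewrite -/(down2 k).
  have := @falling_le (4 * n - k) (leq_subr _ _); rewrite natrB // -/(up2 k).
  rewrite /up1 /down1; lra.
set a := Num.min (up1 i) (up2 k); set b := Num.min (down1 i) (down2 k).
have a0 : 0 <= a by rewrite le_min u1.
have b0 : 0 <= b by rewrite le_min d1.
have t1 : 0 <= a * g i.+1 k.+2.
  have [i1|i1] := leqP i.+1 n; last by rewrite /a (up1_out hi i1) min_l ?mul0r.
  have [k1|k1] := leqP k.+2 (4 * n); last by rewrite /a (up2_out hk k1) min_r ?mul0r.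
  by rewrite mulr_ge0 // g0.
have t2 : 0 <= (up1 i - a) * g i.+1 k.
  have [i1|i1] := leqP i.+1 n; last by rewrite /a (up1_out hi i1) min_l ?subrr ?mul0r.
  by rewrite mulr_ge0 ?g0 // subr_ge0 ge_min lexx.
have t3 : 0 <= (up2 k - a) * g i k.+2.
  have [k1|k1] := leqP k.+2 (4 * n); last by rewrite /a (up2_out hk k1) min_r ?subrr ?mul0r.
  by rewrite mulr_ge0 ?g0 // subr_ge0 ge_min lexx orbT.
have hi' : (i.-1 <= n)%N by rewrite (leq_trans (leq_pred _)).
have hk' : (k - 2 <= 4 * n)%N by rewrite (leq_trans (leq_subr _ _)).
have t4 : 0 <= b * g i.-1 (k - 2)%N by rewrite mulr_ge0 // g0.
have t5 : 0 <= (down1 i - b) * g i.-1 k.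
  by rewrite mulr_ge0 ?g0 // subr_ge0 ge_min lexx.
have t6 : 0 <= (down2 k - b) * g i (k - 2)%N.
  by rewrite mulr_ge0 ?g0 // subr_ge0 ge_min lexx orbT.
rewrite /step /generator -/a -/b.
have -> : g i k = (5 * n%:R)^-1 * (5 * n%:R * g i k).
  by rewrite mulKf // mulf_neq0 // lt0r_neq0.
rewrite -mulrDr mulr_ge0 // ?invr_ge0 ?mulr_ge0 //.
rewrite mulKf; last by rewrite mulf_neq0 // lt0r_neq0.
(* The coefficient is 5 n times the holding probability; a common jump is counted once, hence the
   subtraction of [a] and [b]. *)
have : 0 <= (5 * n%:R - (up1 i + up2 k - a + (down1 i + down2 k - b))) * g i k.
  rewrite mulr_ge0 //; lra.
lra.
Qed.

Lemma stepP (c : R) g h i k :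
  step (fun i k => c * g i k + h i k) i k = c * step g i k + step h i k.
Proof. by rewrite /step /generator; ring. Qed.

(* A coupling, given by its expectation functional; only the values of the integrand
   on [0, n] x [0, 4 n] matter, by the second clause. *)
Definition coupling_functional (E : (nat -> nat -> R) -> R) :=
  [/\ forall (c : R) g h, E (fun i k => c * g i k + h i k) = c * E g + E h,
      forall g, (forall i k, (i <= n)%N -> (k <= 4 * n)%N -> 0 <= g i k) -> 0 <= E g,
      forall g : nat -> R, E (fun i _ => g i) = binomial_mean n g &
      forall g : nat -> R, E (fun _ k => g k) = binomial_mean (4 * n) g].

Lemma coupling_functional_le E g h : coupling_functional E ->
  (forall i k, (i <= n)%N -> (k <= 4 * n)%N -> g i k <= h i k) -> E g <= E h.
Proof.
case=> lin pos _ _ gh; rewrite -subr_ge0 addrC -mulN1r -lin.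
by apply: pos => i k hi hk; rewrite mulN1r addrC subr_ge0 gh.
Qed.

Lemma coupling_functional_product :
  coupling_functional
    (fun g => binomial_mean n (fun i => binomial_mean (4 * n) (g i))).
Proof.
split=> [c g h|g g0|g|g].
- by rewrite -binomial_meanP; congr binomial_mean; apply/funext => i; rewrite binomial_meanP.
- rewrite -(binomial_mean_cst n 0); apply: binomial_mean_le => i hi.
  rewrite -[leLHS](binomial_mean_cst (4 * n) 0); apply: binomial_mean_le => k hk.
  exact: g0.
- by congr binomial_mean; apply/funext => i; rewrite binomial_mean_cst.
- by rewrite binomial_mean_cst.
Qed.

(** On a function of one coordinate the common rate cancels, leaving the generator of the marginal
    chain, whose binomial mean is 0. *)
Lemma coupling_functional_step E :
  coupling_functional E -> coupling_functional (fun g => E (step g)).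
Proof.
move=> EC; have [lin pos m1 m2] := EC; split=> [c g h|g g0|g|g].
- by rewrite -lin; congr E; apply/funext => i; apply/funext => k; rewrite stepP.
- by apply: pos; exact: step_ge0.
- transitivity (E (fun i _ => (5 * n%:R)^-1 *
      ((n%:R - i%:R) * (g i.+1 - g i) + i%:R * (g i.-1 - g i)) + g i)).
    congr E; apply/funext => i; apply/funext => k.
    by rewrite /step /generator /up1 /down1; ring.
  by rewrite lin !m1 binomial_mean_stationary1 mulr0 add0r.
- transitivity (E (fun _ k => (5 * n%:R * (8 * n%:R))^-1 *
      (((4 * n)%:R - k%:R) * ((4 * n)%:R - k%:R - 1) * (g k.+2 - g k) +
       k%:R * (k%:R - 1) * (g (k - 2)%N - g k)) + g k)).
    congr E; apply/funext => i; apply/funext => k.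
    by rewrite /step /generator /up2 /down2 !invfM; ring.
  by rewrite lin !m2 binomial_mean_stationary2 mulr0 add0r.
Qed.

Definition gap i k : R := 2 * (2 * i%:R - n%:R) - (2 * k%:R - (4 * n)%:R).

(** A symmetric majorant of exp(theta |F|), written as two exponentials so that the drift inequality
    applies to F and to - F separately. *)
Definition cosh2 (theta F : R) : R := expR (theta * F) + expR (theta * - F).

(** Common jumps keep the gap; an up jump of i alone or a down jump of k alone adds 4, the two
    others subtract 4. Where truncated subtraction falsifies this, the rate vanishes. *)
Lemma generator_gap (phi : R -> R) i k : (i <= n)%N -> (k <= 4 * n)%N ->
  generator (fun i k => phi (gap i k)) i k =
  (up2 k - Num.min (up1 i) (up2 k) + (down1 i - Num.min (down1 i) (down2 k))) *
    (phi (gap i k - 4) - phi (gap i k)) +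
  (up1 i - Num.min (up1 i) (up2 k) + (down2 k - Num.min (down1 i) (down2 k))) *
    (phi (gap i k + 4) - phi (gap i k)).
Proof.
move=> hi hk; rewrite /generator.
have -> : gap i.+1 k.+2 = gap i k by rewrite /gap -!natr1; ring.
have -> : gap i.+1 k = gap i k + 4 by rewrite /gap -!natr1; ring.
have -> : gap i k.+2 = gap i k - 4 by rewrite /gap -!natr1; ring.
set b := Num.min (down1 i) (down2 k).
have e4 : b * (phi (gap i.-1 (k - 2)%N) - phi (gap i k)) = 0.
  case: (posnP i) => i0; first by rewrite /b i0 min_l ?mul0r ?down2_ge0.
  have [k2|k2] := ltnP k 2; first by rewrite /b (down2_out k2) min_r ?mul0r.
  suff -> : gap i.-1 (k - 2)%N = gap i k by rewrite subrr mulr0.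
  by rewrite /gap natrB // -subn1 natrB //; ring.
have e5 : (down1 i - b) * (phi (gap i.-1 k) - phi (gap i k)) =
          (down1 i - b) * (phi (gap i k - 4) - phi (gap i k)).
  case: (posnP i) => i0.
    by rewrite /b i0 min_l ?down2_ge0 // subrr !mul0r.
  suff -> : gap i.-1 k = gap i k - 4 by [].
  by rewrite /gap -subn1 natrB //; ring.
have e6 : (down2 k - b) * (phi (gap i (k - 2)%N) - phi (gap i k)) =
          (down2 k - b) * (phi (gap i k + 4) - phi (gap i k)).
  have [k2|k2] := ltnP k 2; first by rewrite /b (down2_out k2) min_r ?subrr ?mul0r.
  suff -> : gap i (k - 2)%N = gap i k + 4 by [].
  by rewrite /gap natrB //; ring.
by rewrite e4 e5 e6; ring.
Qed.

Lemma generator_cosh2 (theta : R) i k : 0 < theta -> theta <= 3 / 8 ->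
  (i <= n)%N -> (k <= 4 * n)%N ->
  generator (fun i k => cosh2 theta (gap i k)) i k <=
  - (1 - expR (- (4 * theta))) * cosh2 theta (gap i k) +
  2 * drift_const theta * expR ((2 * k%:R - (4 * n)%:R) ^+ 2 / (4 * (4 * n)%:R)).
Proof.
move=> t0 t38 hi hk; rewrite generator_gap //.
(* With s = 2 k - 4 n, [up2 k] expands to n/2 - s/4 + V - 1/4 + e, while [up1 i] is n/2 - (2 i -
   n)/2; the down rates follow by the reflection s to - s. The bound on [e] is |s| <= 4 n. *)
pose V : R := (2 * k%:R - (4 * n)%:R) ^+ 2 / (32 * n%:R).
pose e : R := (2 * k%:R - (4 * n)%:R) / (16 * n%:R).
have nn : n%:R != 0 :> R by rewrite lt0r_neq0.
have -> : (2 * k%:R - (4 * n)%:R) ^+ 2 / (4 * (4 * n)%:R) = 2 * V.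
  by rewrite /V natrM; field.
have V0 : 0 <= V by rewrite divr_ge0 ?sqr_ge0 ?mulr_ge0.
have e0 : `|e| <= 4^-1.
  rewrite /e normrM [X in _ * X]ger0_norm ?invr_ge0 ?mulr_ge0 // ler_pdivrMr ?mulr_gt0 //.
  rewrite ler_norml natrM.
  have : k%:R <= 4 * n%:R :> R by rewrite -natrM ler_nat.
  have : 0 <= k%:R :> R by [].
  by move=> ? ?; apply/andP; split; lra.
have hu : up2 k - up1 i = V - 4^-1 + e + gap i k / 4.
  by rewrite /up2 /up1 /V /e /gap natrM; field.
have hd : down2 k - down1 i = V - 4^-1 - e - gap i k / 4.
  by rewrite /down2 /down1 /V /e /gap natrM; field.
have D1 := expR_drift t0 t38 V0 e0 hu hd.
(* Exchanging up and down rates and negating [e] gives the hypotheses of the drift inequality at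
   minus the gap. *)
have e0' : `|- e| <= 4^-1 by rewrite normrN.
have hd' : down2 k - down1 i = V - 4^-1 + - e + - gap i k / 4 by rewrite hd; ring.
have hu' : up2 k - up1 i = V - 4^-1 - - e - - gap i k / 4 by rewrite hu; ring.
have D2 := expR_drift t0 t38 V0 e0' hd' hu'.
have oD F : - F - 4 = - (F + 4) :> R by ring.
have oB F : - F + 4 = - (F - 4) :> R by ring.
rewrite oD oB in D2.
rewrite /cosh2; lra.
Qed.

(** The error term of the drift depends on k alone, so its expectation is fixed by the second
    marginal and the Gaussian bound holds for every coupling. *)
Lemma coupling_functional_contract (theta : R) E :
  0 < theta -> theta <= 3 / 8 -> coupling_functional E ->
  E (step (fun i k => cosh2 theta (gap i k))) <=
  (1 - (1 - expR (- (4 * theta))) / (5 * n%:R)) * E (fun i k => cosh2 theta (gap i k)) +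
  2 * drift_const theta * expR (2^-1) / (5 * n%:R).
Proof.
move=> t0 t38 EC; have [lin pos m1 m2] := EC.
set al := 1 - expR _; set D := 2 * _.
have n5 : 0 < (5 * n%:R)^-1 :> R by rewrite invr_gt0 mulr_gt0.
have D0 : 0 <= D by rewrite mulr_ge0 ?drift_const_ge0.
pose G k : R := expR ((2 * k%:R - (4 * n)%:R) ^+ 2 / (4 * (4 * n)%:R)).
apply: (@le_trans _ _ (E (fun i k => (1 - al / (5 * n%:R)) * cosh2 theta (gap i k) +
    (D / (5 * n%:R)) * G k))).
  apply: (coupling_functional_le EC) => i k hi hk.
  have := generator_cosh2 t0 t38 hi hk; rewrite -/al -/D -/(G k).
  rewrite -subr_ge0 => /(mulr_ge0 (ltW n5)).
  by rewrite /step; lra.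
rewrite lin lerD2l.
have -> : E (fun _ k => D / (5 * n%:R) * G k) = D / (5 * n%:R) * E (fun _ k => G k).
  rewrite -[RHS]addr0 -(_ : E (fun _ _ => 0) = 0) -?lin.
    by congr E; apply/funext => i; apply/funext => k; rewrite addr0.
  by rewrite (m1 (fun=> 0)) binomial_mean_cst.
rewrite m2 [leRHS]mulrAC ler_wpM2l //.
  by rewrite mulr_ge0 // ltW.
by apply: binomial_mean_gauss; rewrite muln_gt0.
Qed.

Lemma coupling_functional_bounded (theta : R) : 0 < theta -> theta <= 3 / 8 ->
  exists E, coupling_functional E /\
    E (fun i k => cosh2 theta (gap i k)) <=
    1 + 2 * drift_const theta * expR (2^-1) / (1 - expR (- (4 * theta))).
Proof.
move=> t0 t38.
set al := 1 - expR _; set K := 2 * _ * _.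
have al0 : 0 < al by rewrite subr_gt0 expR_lt1; lra.
have al1 : al <= 1 by rewrite gerBl expR_ge0.
have n5 : 0 < 5 * n%:R :> R by rewrite mulr_gt0.
pose s := al / (5 * n%:R).
have s0 : 0 < s by rewrite divr_gt0.
have s1 : s <= 1.
  rewrite ler_pdivrMr // mul1r.
  have : 1 <= n%:R :> R by rewrite ler1n.
  lra.
pose f i k := cosh2 theta (gap i k).
pose E0 g := binomial_mean n (fun i => binomial_mean (4 * n) (g i)).
have E0C : coupling_functional E0 by exact: coupling_functional_product.
have f0 : 0 <= E0 f.
  by case: E0C => _ pos _ _; apply: pos => i k _ _; rewrite addr_ge0 ?expR_ge0.
have [t ht] := exprn_contraction_le1 s0 s1 f0.
(* [K / al] is the fixed point of the affine recursion and does not depend on n; only the number of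
   steps does. The excess over it shrinks by 1 - s at each step. *)
have [E [EC Ef]] : exists E, coupling_functional E /\
    E f - K / al <= (1 - s) ^+ t * (E0 f).
  elim: {ht}t => [|t [E [EC Ef]]].
    exists E0; split => //; rewrite expr0 mul1r gerBl.
    by rewrite divr_ge0 ?(ltW al0) // !mulr_ge0 ?expR_ge0 ?drift_const_ge0.
  exists (fun g => E (step g)); split; first exact: coupling_functional_step.
  have := coupling_functional_contract t0 t38 EC; rewrite -/al -/K -/s -/f => h.
  have KE : K / (5 * n%:R) = s * (K / al) by rewrite /s; field; rewrite !lt0r_neq0.
  rewrite KE in h.
  have : (1 - s) * (E f - K / al) <= (1 - s) ^+ t.+1 * E0 f.
    by rewrite exprS -mulrA ler_wpM2l // subr_ge0.
  lra.
exists E; split => //; rewrite -/f; lra.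
Qed.

End coupled_chain.

(** * Probability measures on finite sets *)

Definition discrete_space (I : finType) (x0 : I) : Type := I.

HB.instance Definition _ (I : finType) (x0 : I) := Choice.on (discrete_space x0).
HB.instance Definition _ (I : finType) (x0 : I) := isPointed.Build (discrete_space x0) x0.
HB.instance Definition _ (I : finType) (x0 : I) :=
  @isMeasurable.Build default_measure_display (discrete_space x0)
    discrete_measurable discrete_measurable0 discrete_measurableC discrete_measurableU.

Definition discrete_rv (R : realType) (I : finType) (x0 : I) (f : I -> R) :
  discrete_space x0 -> R := f.
Arguments discrete_rv {R I} x0 f.

Lemma measurable_discrete_rv (R : realType) (I : finType) (x0 : I) (f : I -> R) :
  measurable_fun setT (discrete_rv x0 f).
Proof. by move=> _ Y _. Qed.

HB.instance Definition _ (R : realType) (I : finType) (x0 : I) (f : I -> R) :=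
  isMeasurableFun.Build _ _ _ _ (discrete_rv x0 f) (@measurable_discrete_rv R I x0 f).

Section finite_probability.
Variables (R : realType) (I : finType) (x0 : I) (p : I -> R).
Hypotheses (p_ge0 : forall i, 0 <= p i) (p_sum1 : \sum_i p i = 1).
Local Notation T := (discrete_space x0).

(** Indexed by the rank in [enum I] because [msum] adds up a sequence of measures. *)
Definition point_mass (j : nat) : {measure set T -> \bar R} :=
  mscale (NngNum (p_ge0 (nth x0 (enum I) j))) (dirac (nth x0 (enum I) j : T)).

Definition finite_prob : set T -> \bar R := msum point_mass (size (enum I)).
HB.instance Definition _ := Measure.on finite_prob.

Lemma finite_probE (A : set T) : finite_prob A = (\sum_(i | (i : T) \in A) p i)%:E.
Proof.
transitivity (\sum_(i <- enum I) (p i * ((i : T) \in A)%:R)%:E)%E.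
  rewrite (big_nth x0) big_mkord; apply: eq_bigr => j _.
  by rewrite /point_mass /= /mscale /= diracE EFinM.
rewrite sumEFin; congr EFin.
rewrite big_enum big_mkcond [RHS]big_mkcond /=; apply: eq_bigr => i _ /=.
by case: ifP => _; rewrite ?mulr1 ?mulr0.
Qed.

Lemma finite_prob_setT : finite_prob setT = 1%E.
Proof.
rewrite finite_probE -p_sum1; congr EFin.
by apply: eq_bigl => i; rewrite in_setT.
Qed.

HB.instance Definition _ := Measure_isProbability.Build _ _ _ finite_prob finite_prob_setT.

Lemma finite_integral (f : T -> \bar R) : (forall x, 0 <= f x)%E ->
  (\int[finite_prob]_x f x = \sum_i (p i)%:E * f i)%E.
Proof.
move=> f0; rewrite /finite_prob ge0_integral_measure_sum //.
transitivity (\sum_(i <- enum I) (p i)%:E * f i)%E; last by rewrite big_enum.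
rewrite (big_nth x0) big_mkord; apply: eq_bigr => j _.
by rewrite ge0_integral_mscale //= integral_dirac //= diracT mul1e.
Qed.

Definition finite_probability : probability T R := finite_prob.

End finite_probability.

(** * Fair signs on the cube and the law of their sum *)

Section fair_signs.
Variables (R : realType) (N : nat).
Local Notation W := {ffun 'I_N -> bool}.

Definition sign_of (b : bool) : R := if b then 1 else -1.
Definition sign_weight (w : W) : R := 2^-1 ^+ N.

Lemma sign_weight_ge0 w : 0 <= sign_weight w.
Proof. by rewrite exprn_ge0. Qed.

Lemma sign_weight_sum1 : \sum_w sign_weight w = 1.
Proof.
rewrite sumr_const card_ffun card_bool card_ord /sign_weight -[LHS]mulr_natl natrX -exprMn.
by rewrite divff ?expr1n.
Qed.

Definition sign_prob := finite_probability [ffun=> true] sign_weight_ge0 sign_weight_sum1.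

Definition sign_rv (i : 'I_N) : {RV sign_prob >-> R} :=
  discrete_rv [ffun=> true] (fun w : W => sign_of (w i)).

Definition sign_sum : {RV sign_prob >-> R} :=
  discrete_rv [ffun=> true] (fun w : W => \sum_(i < N) sign_of (w i)).

Definition sign_law (A : set R) : R := \sum_(b : bool) 2^-1 * (sign_of b \in A)%:R.

(** The uniform weight and the indicator both factor over coordinates, so the sum over sign vectors
    is a product of sums; a coordinate outside [J] contributes 1/2 + 1/2 = 1. *)
Lemma sign_prob_cylinder (J : {set 'I_N}) (A : 'I_N -> set R) :
  sign_prob [set w | forall i, i \in J -> A i (sign_rv i w)] =
  (\prod_(i in J) sign_law (A i))%:E.
Proof.
rewrite [LHS]finite_probE; congr EFin.
transitivity (\sum_(w : W) \prod_i (2^-1 * ((i \in J) ==> (sign_of (w i) \in A i))%:R : R)).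
  rewrite big_mkcond /=; apply: eq_bigr => w _.
  rewrite big_split /= prodr_const card_ord -/(sign_weight w).
  case: ifPn => [/set_mem /= hw|hw].
    rewrite big1 ?mulr1 // => i _; case: (boolP (i \in J)) => //= iJ.
    by rewrite mem_set //; exact: hw.
  have /existsP[i] : [exists i, ~~ ((i \in J) ==> (sign_of (w i) \in A i))].
    rewrite -negb_forall; apply: contra hw => /forallP hw.
    by apply/mem_set => i iJ /=; apply/set_mem; have /implyP := hw i; exact.
  by move=> /negbTE hi; rewrite (bigD1 i) //= hi mul0r mulr0.
rewrite -(bigA_distr_bigA (fun i b => 2^-1 * ((i \in J) ==> (sign_of b \in A i))%:R)) /=.
rewrite [RHS]big_mkcond /=; apply: eq_bigr => i _.
case: ifP => // _; rewrite big_bool /=; lra.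
Qed.

Lemma sign_prob_event (i : 'I_N) (A : set R) :
  sign_prob [set w | A (sign_rv i w)] = (sign_law A)%:E.
Proof.
have := sign_prob_cylinder [set i]%SET (fun=> A); rewrite big_set1 => <-.
congr (sign_prob _); apply/seteqP; split => w /=.
- by move=> h j; rewrite inE => /eqP ->.
- by move=> h; apply: h; rewrite inE.
Qed.

Lemma sign_rv_independent : mutually_independent sign_rv.
Proof.
move=> J A _; rewrite sign_prob_cylinder -prodEFin.
by apply: eq_bigr => i _; rewrite sign_prob_event.
Qed.

Lemma sign_rv_fair i : fair_sign (sign_rv i).
Proof.
have n1 : (1 : R) != -1 by rewrite gt_eqF // (@lt_trans _ _ 0) // oppr_lt0.
split.
- rewrite (sign_prob_event i [set x | x = 1]) /sign_law big_bool /= mem_set //.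
  rewrite memNset //=; last by move/eqP; rewrite eq_sym (negbTE n1).
  by rewrite mulr1 mulr0 addr0.
- rewrite (sign_prob_event i [set x | x = -1]) /sign_law big_bool /=.
  rewrite memNset //=; last by move/eqP; rewrite (negbTE n1).
  by rewrite mem_set // mulr1 mulr0 add0r.
Qed.

(** Sign vectors are identified with subsets and grouped by cardinality. *)
Lemma sum_binomial (phi : nat -> R) :
  \sum_(w : W) sign_weight w * phi #|[set i | w i]%SET| = binomial_mean N phi.
Proof.
rewrite (reindex (fun B : {set 'I_N} => [ffun i => i \in B])) /=; last first.
  exists (fun w : W => [set i | w i]%SET) => [B _|w _].
    by apply/setP => i; rewrite inE ffunE.
  by apply/ffunP => i; rewrite ffunE inE.
have card_le (B : {set 'I_N}) : (#|B| < N.+1)%N.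
  by rewrite ltnS -[leqRHS]card_ord max_card.
rewrite (partition_big (fun B : {set 'I_N} => Ordinal (card_le B)) xpredT) //=.
apply: eq_bigr => k _.
transitivity (\sum_(B : {set 'I_N} | B \in [set B : {set 'I_N} | #|B| == k]%SET) 2^-1 ^+ N * phi k).
  apply: eq_big => [B|B /eqP <-]; first by rewrite inE -val_eqE.
  congr (_ * phi _); apply: eq_card => i; by rewrite !inE ffunE.
by rewrite sumr_const card_draws card_ord -[LHS]mulr_natl exprVn mulrA.
Qed.

Lemma sign_sum_card (w : W) :
  \sum_(i < N) sign_of (w i) = 2 * #|[set i | w i]%SET|%:R - N%:R.
Proof.
have -> : N%:R = \sum_(i < N) 1 :> R by rewrite sumr_const card_ord.
have -> : #|[set i | w i]%SET|%:R = \sum_(i < N) (w i)%:R :> R.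
  rewrite -sum1_card natr_sum big_mkcond /=; apply: eq_bigr => i _.
  by rewrite inE; case: (w i).
rewrite mulr_sumr -sumrB; apply: eq_bigr => i _.
by rewrite /sign_of; case: (w i) => /=; lra.
Qed.

Lemma sign_sum_law (A : set R) :
  distribution sign_prob sign_sum A =
  (binomial_mean N (fun k => (2 * k%:R - N%:R \in A)%:R))%:E.
Proof.
rewrite /distribution /pushforward [LHS]finite_probE -sum_binomial; congr EFin.
rewrite big_mkcond /=; apply: eq_bigr => w _; rewrite -sign_sum_card.
case: ifPn => [/set_mem /= h|h].
  by rewrite mem_set ?mulr1.
by rewrite memNset ?mulr0 // => h'; move/negP: h; apply; apply/mem_set.
Qed.

End fair_signs.

Lemma distributed_as_SP (R : realType) (N : nat) (d : measure_display)
    (T : measurableType d) (P : probability T R) (X : {RV P >-> R}) :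
  (forall A : set R, distribution P X A =
    (binomial_mean N (fun k => (2 * k%:R - N%:R \in A)%:R))%:E) ->
  distributed_as_S N X.
Proof.
move=> hX; exists _, _, (sign_prob R N), (sign_sum R N); split.
  exists (@sign_rv R N); split => //; [exact: sign_rv_independent|exact: sign_rv_fair].
by move=> A _; rewrite hX sign_sum_law.
Qed.

(** * From an expectation functional to a probability space *)

Section coupling_of_functional.
Variables (R : realType) (n : nat) (E : (nat -> nat -> R) -> R).
Hypothesis EC : coupling_functional n E.
Local Notation I := ('I_n.+1 * 'I_(4 * n).+1)%type.

Definition functional_weight (x : I) : R :=
  E (fun i k => ((i == x.1) && (k == x.2))%:R).

Lemma functional_weight_ge0 x : 0 <= functional_weight x.
Proof. by case: EC => _ pos _ _; apply: pos. Qed.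

Lemma functional_sum (J : Type) (r : seq J) (F : J -> nat -> nat -> R) (c : J -> R) :
  E (fun i k => \sum_(j <- r) c j * F j i k) = \sum_(j <- r) c j * E (F j).
Proof.
case: EC => lin _ m1 _; elim: r => [|j r IH].
  rewrite big_nil -[RHS](binomial_mean_cst n 0) -m1.
  by congr E; apply/funext => i; apply/funext => k; rewrite big_nil.
rewrite big_cons -IH -lin.
by congr E; apply/funext => i; apply/funext => k; rewrite big_cons.
Qed.

(** [g] agrees on the rectangle with its expansion in point indicators; monotonicity of [E], applied
    in both directions, ignores the values elsewhere. *)
Lemma functional_weightE (g : nat -> nat -> R) :
  E g = \sum_(x : I) functional_weight x * g x.1 x.2.
Proof.
transitivity (\sum_(x : I) g x.1 x.2 * functional_weight x); last first.
  by apply: eq_bigr => x _; rewrite mulrC.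
rewrite /functional_weight -functional_sum.
have eqg i k : (i <= n)%N -> (k <= 4 * n)%N ->
    \sum_(x : I) g x.1 x.2 * ((i == x.1) && (k == x.2))%:R = g i k.
  move=> hi hk; rewrite (bigD1 (@Ordinal n.+1 i hi, @Ordinal (4 * n).+1 k hk)) //= !eqxx mulr1.
  rewrite big1 ?addr0 // => -[i' k']; rewrite -pair_eqE /= -!val_eqE /= negb_and.
  by rewrite eq_sym [in X in _ || X]eq_sym -negb_and => /negbTE ->; rewrite mulr0.
by apply/eqP; rewrite eq_le; apply/andP; split; apply: (coupling_functional_le EC) => i k hi hk;
  rewrite eqg.
Qed.

Lemma functional_weight_sum1 : \sum_x functional_weight x = 1.
Proof.
have := functional_weightE (fun _ _ => 1); case: EC => _ _ m1 _.
rewrite (m1 (fun=> 1)) binomial_mean_cst => ->.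
by apply: eq_bigr => x _; rewrite mulr1.
Qed.

Definition coupling_prob :=
  finite_probability (ord0, ord0) functional_weight_ge0 functional_weight_sum1.

Definition coupling_fst : {RV coupling_prob >-> R} :=
  discrete_rv (ord0, ord0) (fun x : I => 2 * (x.1 : nat)%:R - n%:R).

Definition coupling_snd : {RV coupling_prob >-> R} :=
  discrete_rv (ord0, ord0) (fun x : I => 2 * (x.2 : nat)%:R - (4 * n)%:R).

Lemma coupling_prob_distribution (f : nat -> nat -> R) (A : set R) :
  distribution coupling_prob (discrete_rv (ord0, ord0) (fun x : I => f x.1 x.2)) A =
  (E (fun i k => (f i k \in A)%:R))%:E.
Proof.
rewrite /distribution /pushforward [LHS]finite_probE functional_weightE; congr EFin.
rewrite big_mkcond /=; apply: eq_bigr => x _.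
case: ifPn => [/set_mem /= h|h].
  by rewrite mem_set ?mulr1.
by rewrite memNset ?mulr0 // => h'; move/negP: h; apply; apply/mem_set.
Qed.

Lemma coupling_prob_is_coupling : is_coupling_S n (4 * n) coupling_fst coupling_snd.
Proof.
have [_ _ m1 m2] := EC.
split; apply: distributed_as_SP => A.
  by rewrite (coupling_prob_distribution (fun i _ => 2 * i%:R - n%:R)) -m1.
by rewrite (coupling_prob_distribution (fun _ k => 2 * k%:R - (4 * n)%:R)) -m2.
Qed.

Lemma coupling_prob_expectation (phi : R -> R -> R) : (forall x y, 0 <= phi x y) ->
  ('E_coupling_prob[fun w => phi (coupling_fst w) (coupling_snd w)] =
  (E (fun i k => phi (2 * i%:R - n%:R) (2 * k%:R - (4 * n)%:R)))%:E)%E.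
Proof.
move=> phi0; rewrite unlock [LHS]finite_integral => [|x]; last by rewrite lee_fin phi0.
rewrite functional_weightE -sumEFin; apply: eq_bigr => x _; by rewrite EFinM.
Qed.

End coupling_of_functional.

(** * Conclusion *)

Lemma coupling_bounded (R : realType) (theta : R) : 0 < theta -> theta <= 3 / 8 ->
  exists kappa : R, forall n : nat, (1 <= n)%N ->
    exists (d : measure_display) (T : measurableType d)
           (P : probability T R) (Sn S4n : {RV P >-> R}),
      is_coupling_S n (4 * n) Sn S4n /\
      ('E_P[fun w => (expR (theta * `|2 * Sn w - S4n w|))%R] <= kappa%:E)%E.
Proof.
move=> t0 t38.
exists (1 + 2 * drift_const theta * expR (2^-1) / (1 - expR (- (4 * theta)))) => n n0.
have [E [EC Ef]] := coupling_functional_bounded n0 t0 t38.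
exists _, _, (coupling_prob EC), (coupling_fst EC), (coupling_snd EC); split.
  exact: coupling_prob_is_coupling.
rewrite (coupling_prob_expectation EC (phi := fun x y => expR (theta * `|2 * x - y|))); last first.
  by move=> x y; exact: expR_ge0.
rewrite lee_fin; apply: le_trans Ef; apply: (coupling_functional_le EC) => i k _ _.
(* exp(theta |F|) is one of the two positive summands, according to the sign of F. *)
rewrite /cosh2 -/(gap _ n i k); have := expR_gt0 (theta * gap R n i k).
have := expR_gt0 (theta * - gap R n i k).
by case: (ger0P (gap R n i k)) => _; lra.
Qed.

Theorem theorem5 (R : realType) :
  (exists theta0 kappa0 : R,
     0 < theta0 /\
     forall n : nat, (1 <= n)%N ->
       exists (d : measure_display) (T : measurableType d)
              (P : probability T R) (Sn S4n : {RV P >-> R}),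
         is_coupling_S n (4 * n) Sn S4n /\
         ('E_P[fun w => (expR (theta0 * `|2 * Sn w - S4n w|))%R] <= kappa0%:E)%E)
  /\
  (forall theta0 : R,
     0 < theta0 -> 8 * theta0 ^+ 2 * expR (2 * theta0) < 1 ->
     exists kappa0 : R,
     forall n : nat, (1 <= n)%N ->
       exists (d : measure_display) (T : measurableType d)
              (P : probability T R) (Sn S4n : {RV P >-> R}),
         is_coupling_S n (4 * n) Sn S4n /\
         ('E_P[fun w => (expR (theta0 * `|2 * Sn w - S4n w|))%R] <= kappa0%:E)%E).
Proof.
split.
  have [|//|kappa hk] := @coupling_bounded R (3 / 8); first by rewrite divr_gt0.
  by exists (3 / 8), kappa; split => //; rewrite divr_gt0.
move=> theta t0 ht; apply: coupling_bounded => //.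
have e1 : 1 <= expR (2 * theta) by apply: le_trans (expR_ge1Dx _); lra.
have t2 : 8 * theta ^+ 2 < 1.
  apply: le_lt_trans ht; rewrite -[leLHS]mulr1 ler_wpM2l //.
  by rewrite mulr_ge0 ?sqr_ge0.
(* Beyond 3 / 8, 8 theta^2 would exceed 9 / 8. *)
by rewrite leNgt; apply/negP => h; nra.
Qed.
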